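(* Two finite ultrametric spaces are indistinguishable if and only if their cardinalities are the same and their $\operatorname{mst}$-spectra coincide.
   Context: All metric spaces are non-empty; $|xy|$ is the distance between $x$ and $y$. A metric space $X$ is ultrametric if $|xz|\le\max\{|xy|,|yz|\}$ for all $x,y,z\in X$. $d_{GH}$ is the Gromov--Hausdorff distance: the infimum of the $r$ such that $X$ and $Y$ embed isometrically in a common metric space with Hausdorff distance between their images at most $r$. For a cardinal $n\ge1$, $\Delta_n$ is the metric space of cardinality $n$ with all non-zero distances equal to $1$; for $\lambda>0$, $\lambda\Delta_n$ is obtained by multiplying all distances by $\lambda$, and $0\Delta_n:=\Delta_1$ (one point). The spaces $\lambda\Delta_n$ are called simplexes. Metric spaces $X$ and $Y$ are indistinguishable if $d_{GH}(\lambda\Delta_n,X)=d_{GH}(\lambda\Delta_n,Y)$ for every cardinal $n\ge1$ and every real $\lambda\ge0$. For a finite metric space $M$, a minimal spanning tree on $M$ is a tree $G=(M,E)$ with vertex set $M$ whose total edge length (the length of an edge $vw$ being $|vw|$) is minimal among all trees with vertex set $M$. The vector of edge lengths of $G$, written in descending order, does not depend on the choice of the minimal spanning tree $G$; it is denoted by $\sigma(M)$ and called the $\operatorname{mst}$-spectrum of $M$. *)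

(* Defs.v *)
From HB Require Import structures.
From mathcomp Require Import all_boot all_order all_algebra.
From mathcomp Require Import all_classical all_reals all_analysis.

Set Implicit Arguments.
Unset Strict Implicit.
Unset Printing Implicit Defensive.

Import Order.TTheory GRing.Theory Num.Theory.

Local Open Scope classical_set_scope.
Local Open Scope ring_scope.

(** [metricType R] is the library's metric space; it may be empty, so
    non-emptiness is always an explicit hypothesis below. *)

#[short(type="finMetricType")]
HB.structure Definition FinMetric (R : numDomainType) :=
  { M of Metric R M & Finite M }.

Definition ultrametric (R : realType) (X : metricType R) : Prop :=
  forall x y z : X, mdist x z <= Num.max (mdist x y) (mdist y z).

(** * Gromov-Hausdorff distance *)

Definition dist_to_set (R : realType) (Z : metricType R) (z : Z) (A : set Z)
    : \bar R :=
  ereal_inf [set (mdist z a)%:E | a in A].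

Definition hausdorff_dist (R : realType) (Z : metricType R) (A B : set Z)
    : \bar R :=
  Order.max (ereal_sup [set dist_to_set a B | a in A])
            (ereal_sup [set dist_to_set b A | b in B]).

Definition isometric_embedding (R : realType) (X Z : metricType R)
    (f : X -> Z) : Prop :=
  forall x y : X, mdist (f x) (f y) = mdist x y.

(** Extended-real valued: it may be [+oo] on arbitrary metric spaces. *)
Definition gh_dist (R : realType) (X Y : metricType R) : \bar R :=
  ereal_inf [set r%:E | r in [set r : R |
    exists (Z : metricType R) (f : X -> Z) (g : Y -> Z),
      [/\ isometric_embedding f, isometric_embedding g &
          (hausdorff_dist (range f) (range g) <= r%:E)%E]]].

(** * Simplexes *)

(** A cardinal is represented by a type of that cardinality; [{classic T}] only
    equips [T] with a (classical) decidable equality and choice operator. *)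
Definition delta (R : realType) (T : Type) : Type := {classic T}.

Section DeltaMetric.
Variables (R : realType) (T : Type).

HB.instance Definition _ := Choice.on (delta R T).

Let d (x y : delta R T) : R := (x != y)%:R.

Let dxx x : d x x = 0.
Proof. by rewrite /d eqxx. Qed.

Let d_positivity x y : d x y = 0 -> x = y.
Proof. by rewrite /d; case: eqP => // _ /eqP; rewrite oner_eq0. Qed.

Let d_sym x y : d x y = d y x.
Proof. by rewrite /d eq_sym. Qed.

Let d_triangle y x z : d x z <= d x y + d y z.
Proof.
rewrite /d -natrD ler_nat.
by case: (eqVneq x y) => [->|] //=; case: (x != z); case: (y != z).
Qed.

HB.instance Definition _ := @isMetric.Build R (delta R T)
  d dxx d_positivity d_sym d_triangle.

End DeltaMetric.

Definition scaled (R : realType) (lam : R) (lam_gt0 : 0 < lam)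
  (X : metricType R) : Type := X.

Section ScaledMetric.
Variables (R : realType) (lam : R) (lam_gt0 : 0 < lam) (X : metricType R).

HB.instance Definition _ := Choice.on (scaled lam_gt0 X).

Let d (x y : scaled lam_gt0 X) : R := lam * mdist (x : X) (y : X).

Let dxx x : d x x = 0.
Proof. by rewrite /d mdistxx mulr0. Qed.

Let d_positivity x y : d x y = 0 -> x = y.
Proof.
move=> /eqP; rewrite mulf_eq0 gt_eqF //= => /eqP.
exact: mdist_positivity.
Qed.

Let d_sym x y : d x y = d y x.
Proof. by rewrite /d metric_sym. Qed.

Let d_triangle y x z : d x z <= d x y + d y z.
Proof. by rewrite /d -mulrDr ler_pM2l // metric_triangle. Qed.

HB.instance Definition _ := @isMetric.Build R (scaled lam_gt0 X)
  d dxx d_positivity d_sym d_triangle.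

End ScaledMetric.

(** The convention is that the zero multiple of any simplex is the one-point
    space; negative [lam] is never used. *)
Definition simplex (R : realType) (lam : R) (T : Type) : metricType R :=
  match pselect (0 < lam) with
  | left lam_gt0 => scaled lam_gt0 (delta R T)
  | right _ => delta R unit
  end.

Definition indistinguishable (R : realType) (X Y : metricType R) : Prop :=
  forall (T : Type) (lam : R), inhabited T -> 0 <= lam ->
    gh_dist (simplex lam T) X = gh_dist (simplex lam T) Y.

(** * Minimal spanning trees

    A graph with vertex set [X] is given by its set of edges, an edge being a
    two-element set of vertices. *)

Definition adjacent (X : finType) (E : {set {set X}}) : rel X :=
  fun x y => [set x; y]%SET \in E.

Definition is_tree (X : finType) (E : {set {set X}}) : Prop :=
  [/\ forall e, e \in E -> #|e| = 2,
      forall x y, connect (adjacent E) x y &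
      forall c : seq X, (2 < size c)%N -> ~ ucycle (adjacent E) c].

(** On a two-element set [[set v; w]] this is [mdist v w], see
    [edge_length_set2]. *)
Definition edge_length (R : realType) (X : finMetricType R) (e : {set X}) : R :=
  \big[Num.max/0]_(v in e) \big[Num.max/0]_(w in e) mdist v w.
Arguments edge_length {R} X _.

Definition total_length (R : realType) (X : finMetricType R)
    (E : {set {set X}}) : R :=
  \sum_(e in E) edge_length X e.
Arguments total_length {R} X _.

Definition is_mst (R : realType) (X : finMetricType R)
    (E : {set {set X}}) : Prop :=
  is_tree E /\ forall E' : {set {set X}},
    is_tree E' -> total_length X E <= total_length X E'.
Arguments is_mst {R} X _.

Definition edge_lengths (R : realType) (X : finMetricType R)
    (E : {set {set X}}) : seq R :=
  sort (fun s t => t <= s) [seq edge_length X e | e <- enum E].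
Arguments edge_lengths {R} X _.

(** The spectrum of some minimal spanning tree; one exists when [X] is
    non-empty, see [mst_exists]. *)
Definition mst_spectrum (R : realType) (X : finMetricType R) : seq R :=
  edge_lengths X (xget finset.set0 [set E : {set {set X}} | is_mst X E]).

Lemma edge_length_set2 (R : realType) (X : finMetricType R) (v w : X) :
  edge_length X [set v; w]%SET = mdist v w.
Proof.
apply/eqP; rewrite eq_le /edge_length; apply/andP; split; last first.
  apply: (bigmax_sup v); first by rewrite !inE eqxx.
  by apply: (bigmax_sup w); rewrite ?inE ?eqxx ?orbT.
apply: bigmax_le => [|x]; first exact: mdist_ge0.
rewrite !inE => xvw; apply: bigmax_le => [|y]; first exact: mdist_ge0.
rewrite !inE => yvw.
case/orP: xvw yvw => /eqP -> /orP[]/eqP ->; rewrite ?mdistxx ?mdist_ge0 //.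
by rewrite metric_sym.
Qed.

Lemma star_is_tree (X : finType) (x0 : X) :
  is_tree [set [set x0; y]%SET | y in [set~ x0]%SET]%SET.
Proof.
set S := (S in is_tree S).
have adjP x y : adjacent S x y ->
    (x = x0 /\ y != x0) \/ (y = x0 /\ x != x0).
  move=> /imsetP[z]; rewrite !inE => zx0 /setP E.
  have := E x; have := E y; have := E x0; have := E z; rewrite !inE !eqxx ?orbT /=.
  move=> Ez E0 /esym/orP[]/eqP yE /esym/orP[]/eqP xE; subst x y; auto.
    by move: Ez; rewrite orbb (negPf zx0).
  by move: E0; rewrite orbb eq_sym (negPf zx0).
have adj0 y : y != x0 -> adjacent S x0 y.
  by move=> yx0; apply/imsetP; exists y => //; rewrite !inE.
have adjC x y : adjacent S x y = adjacent S y x.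
  by rewrite /adjacent finset.setUC.
split.
- move=> e /imsetP[y]; rewrite !inE => yx0 ->.
  by rewrite cards2 eq_sym yx0.
- have c0 y : connect (adjacent S) x0 y.
    by have [->|/adj0] := eqVneq y x0; [exact: connect0 | exact: connect1].
  move=> x y; apply: (connect_trans _ (c0 y)).
  by rewrite (sym_connect_sym adjC).
move=> [|a [|b [|d c]]] //= _; rewrite /ucycle /=.
rewrite rcons_path !inE !negb_or => /andP[].
move=> /and4P[/adjP ab /adjP bd _ /adjP za] /andP[/and3P[_ ad _]].
move=> /andP[/andP[bd' bc] _].
have bz : b != last d c.
  by have := mem_last d c; rewrite inE => /orP[/eqP->//|]; apply: contraTneq => <-.
case: ab => -[e1 n1].
  case: bd => -[e2 n2]; first by rewrite e2 eqxx in n1.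
  by rewrite e1 e2 eqxx in ad.
case: za => -[e3 n3]; first by rewrite e1 e3 eqxx in bz.
by rewrite e3 eqxx in n1.
Qed.

Lemma mst_exists (R : realType) (X : finMetricType R) :
  (0 < #|X|)%N -> exists E : {set {set X}}, is_mst X E.
Proof.
move=> /card_gt0P[x0 _].
pose S := [set [set x0; y]%SET | y in [set~ x0]%SET]%SET.
have SP : `[< is_tree S >] by apply/asboolP/star_is_tree.
case: (@arg_minP _ _ _ S (fun E => `[< is_tree E >]) (total_length X) SP).
move=> E /asboolP Etree Emin; exists E; split=> // E' E'tree.
exact/Emin/asboolP.
Qed.

(* Main.v *)
Require Import Defs.
From HB Require Import structures.
From mathcomp Require Import all_boot all_order all_algebra.
From mathcomp Require Import all_classical all_reals all_analysis.
From mathcomp Require Import lra.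

(** For a finite metric space [X], consider for which [k] and [r > 0] there are
    [k] points of [X] at mutual distances at least [r]. If [X] is ultrametric
    these pairs [(k, r)] determine, and are determined by, both sides of the
    equivalence.

    A minimal spanning tree has at least [k - 1] edges of length at least [r]
    exactly when such [k] points exist: any connected graph on an ultrametric
    space has enough long edges, and the tree attaching each point to its
    nearest predecessor has no more than that. Since the sum of the lengths is
    monotone in the numbers of long edges, every minimal tree has the same
    numbers.

    The distance to an equidistant space [S] is computed with correspondences.
    A correspondence of distortion [s] between [S] and [X] bounds the diameter
    of [X], bounds the number of points at mutual distances above [s], and, if
    the distance [mu] in [S] exceeds [s], provides points of [X], indexed by [S],
    at mutual distances at least [mu - s]. Conversely, in an ultrametric space
    these conditions suffice to build such a correspondence. Taking [mu] large
    recovers the pairs [(k, r)] from the distances to the simplexes. *)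

Set Implicit Arguments.
Unset Strict Implicit.
Unset Printing Implicit Defensive.

Import Order.TTheory GRing.Theory Num.Theory.

Local Open Scope ring_scope.

(** * Gromov-Hausdorff distance and correspondences *)

Record gluing (R : realType) (X Y : metricType R) (h : X -> Y -> R) : Prop := {
  glue_gt0 : forall x y, 0 < h x y;
  glue_lipl : forall x x' y, h x y <= mdist x x' + h x' y;
  glue_lipr : forall x y y', h x y <= h x y' + mdist y' y;
  glue_trl : forall x x' y, mdist x x' <= h x y + h x' y;
  glue_trr : forall x y y', mdist y y' <= h x y + h x y' }.

(** The proof [hP] is a parameter of the type so that the metric declared below can be inferred from
    the type alone. *)
Definition glued (R : realType) (X Y : metricType R) (h : X -> Y -> R)
  (hP : gluing h) : Type := (X + Y)%type.

Section GluedMetric.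
Variables (R : realType) (X Y : metricType R) (h : X -> Y -> R).
Variable hP : gluing h.

HB.instance Definition _ := Choice.copy (glued hP) (X + Y)%type.

Let d (z z' : glued hP) : R :=
  match z, z' with
  | inl x, inl x' => mdist x x'
  | inr y, inr y' => mdist y y'
  | inl x, inr y | inr y, inl x => h x y
  end.

Let dzz z : d z z = 0.
Proof. by case: z => z; rewrite /d mdistxx. Qed.

Let d_positivity z z' : d z z' = 0 -> z = z'.
Proof.
case: z z' => [x|y] [x'|y'] /=; try by move=> /mdist_positivity ->.
- by move=> /eqP; rewrite gt_eqF// (glue_gt0 hP).
- by move=> /eqP; rewrite gt_eqF// (glue_gt0 hP).
Qed.

Let d_sym z z' : d z z' = d z' z.
Proof. by case: z z' => [x|y] [x'|y'] //=; rewrite metric_sym. Qed.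

Let d_triangle z' z z'' : d z z'' <= d z z' + d z' z''.
Proof.
case: z z' z'' => [x|y] [x'|y'] [x''|y''] //=.
- exact: metric_triangle.
- exact: glue_lipl.
- exact: glue_trl.
- exact: glue_lipr.
- by rewrite addrC metric_sym (le_trans (glue_lipl hP x'' x' y))// lerD2r metric_sym.
- exact: glue_trr.
- by rewrite addrC metric_sym (le_trans (glue_lipr hP x'' y y'))// lerD2l metric_sym.
- exact: metric_triangle.
Qed.

HB.instance Definition _ := @isMetric.Build R (glued hP)
  d dzz d_positivity d_sym d_triangle.

End GluedMetric.

Lemma gh_dist_glued (R : realType) (X Y : metricType R) (h : X -> Y -> R)
    (r : R) : gluing h ->
  (forall x, exists y, h x y <= r) -> (forall y, exists x, h x y <= r) ->
  (gh_dist X Y <= r%:E)%E.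
Proof.
move=> hP hX hY; apply: ereal_inf_lbound; exists r => //=.
exists (glued hP : metricType R), inl, inr; split=> //.
rewrite /hausdorff_dist ge_max; apply/andP; split;
  apply: ge_ereal_sup => _ [_ [z _ <-] <-].
- have [y hy] := hX z; apply: ge_ereal_inf; exists (h z y)%:E.
    by exists (inr y) => //; exists y.
  by rewrite lee_fin.
- have [x hx] := hY z; apply: ge_ereal_inf; exists (h x z)%:E.
    by exists (inl x) => //; exists x.
  by rewrite lee_fin.
Qed.

Definition correspondence (R : realType) (X Y : metricType R) (s : R)
    (Q : X -> Y -> Prop) : Prop :=
  [/\ forall x, exists y, Q x y, forall y, exists x, Q x y &
      forall x x' y y', Q x y -> Q x' y' -> `|mdist x x' - mdist y y'| <= s].

(** The spaces are glued by the infimum of detours through related pairs, each pair being placed at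
    distance [r]. Passing through two pairs costs [2 * r], which absorbs the distortion; [0 < r]
    keeps cross distances positive. *)
Lemma gh_dist_correspondence (R : realType) (X Y : metricType R) (r : R)
    (Q : X -> Y -> Prop) :
  0 < r -> correspondence (2 * r) Q -> (gh_dist X Y <= r%:E)%E.
Proof.
move=> r0 [QX QY Qd].
pose D x y : set R :=
  [set mdist x p.1 + r + mdist p.2 y | p in [set p | Q p.1 p.2]]%classic.
have Dge x y t : D x y t -> r <= t.
  case=> p _ <-; have := mdist_ge0 x p.1; have := mdist_ge0 p.2 y; lra.
have D0 x y : (D x y !=set0)%classic.
  by have [y' xy'] := QX x; eexists; exists (x, y').
have Dlb x y : has_lbound (D x y) by exists r => t /Dge.
have infle x y a b : Q a b -> inf (D x y) <= mdist x a + r + mdist b y.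
  by move=> ab; apply: ge_inf => //; exists (a, b).
have leinf x y t : (forall a b, Q a b -> t <= mdist x a + r + mdist b y) ->
    t <= inf (D x y).
  by move=> H; apply: lb_le_inf => // _ [[a b] ab <-]; apply: H.
have hP : gluing (fun x y => inf (D x y)).
  split=> [x y|x x' y|x y y'|x x' y|x y y'].
  - by apply: lt_le_trans r0 _; apply: lb_le_inf => // t /Dge.
  - rewrite -lerBlDl; apply: (leinf) => a b ab; have := infle x y _ _ ab.
    by have := metric_triangle x x' a; lra.
  - rewrite -lerBlDr; apply: (leinf) => a b ab; have := infle x y _ _ ab.
    by have := metric_triangle b y' y; lra.
  - rewrite -lerBlDr; apply: (leinf) => a b ab.
    rewrite lerBlDr -lerBlDl; apply: (leinf) => a' b' ab'.
    have := metric_triangle x a x'; have := metric_triangle a a' x'.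
    have := metric_triangle b y b'; have := Qd _ _ _ _ ab ab'.
    rewrite (metric_sym x' a') (metric_sym y b') ler_norml => /andP[_]; lra.
  - rewrite -lerBlDr; apply: (leinf) => a b ab.
    rewrite lerBlDr -lerBlDl; apply: (leinf) => a' b' ab'.
    have := metric_triangle y b y'; have := metric_triangle b b' y'.
    have := metric_triangle a x a'; have := Qd _ _ _ _ ab ab'.
    rewrite (metric_sym b y) (metric_sym a x) ler_norml => /andP[+ _]; lra.
apply: gh_dist_glued hP _ _ => [x|y].
  have [y xy] := QX x; exists y.
  by have := infle x y _ _ xy; rewrite !mdistxx add0r addr0.
have [x xy] := QY y; exists x.
by have := infle x y _ _ xy; rewrite !mdistxx add0r addr0.
Qed.

(** Distances to the images are infima that need not be attained; the strict bound leaves room to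
    pick for each point a partner closer than [r]. *)
Lemma correspondence_gh_dist (R : realType) (X Y : metricType R) (r : R) :
  (gh_dist X Y < r%:E)%E ->
  exists Q : X -> Y -> Prop, correspondence (2 * r) Q.
Proof.
move=> /ereal_inf_lt[_ [q [Z [f [g [fi gi H]]]] <-]]; rewrite lte_fin => qr.
exists (fun x y => mdist (f x) (g y) < r).
move: H; rewrite /hausdorff_dist ge_max => /andP[Hf Hg]; split=> [x|y|x x' y y'].
- have : (dist_to_set (f x) (range g) < r%:E)%E.
    apply: (@le_lt_trans _ _ q%:E); rewrite ?lte_fin//.
    apply: le_trans Hf; apply: ereal_sup_ubound.
    by exists (f x) => //; exists x.
  move=> /ereal_inf_lt[_ [_ [y _ <-] <-]]; rewrite lte_fin => ?.
  by exists y.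
- have : (dist_to_set (g y) (range f) < r%:E)%E.
    apply: (@le_lt_trans _ _ q%:E); rewrite ?lte_fin//.
    apply: le_trans Hg; apply: ereal_sup_ubound.
    by exists (g y) => //; exists y.
  move=> /ereal_inf_lt[_ [_ [x _ <-] <-]]; rewrite lte_fin metric_sym => ?.
  by exists x.
- rewrite -(fi x x') -(gi y y') ler_norml => H1 H2.
  have := metric_triangle (f x) (g y) (f x').
  have := metric_triangle (g y) (g y') (f x').
  have := metric_triangle (g y) (f x) (g y').
  have := metric_triangle (f x) (f x') (g y').
  rewrite (metric_sym (g y') (f x')) (metric_sym (g y) (f x)).
  by move=> *; apply/andP; split; lra.
Qed.

(** * Points at large mutual distances *)

Section Packing.
Variable R : realType.
Implicit Types (X Y : finMetricType R) (r s : R) (k n : nat).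

Definition spaced X r (A : {set X}) : Prop :=
  {in A &, forall x y, x != y -> r <= mdist x y}.

Definition strictly_spaced X s (A : {set X}) : Prop :=
  {in A &, forall x y, x != y -> s < mdist x y}.

Definition packs X k r : Prop := exists2 A : {set X}, #|A| = k & spaced r A.

Definition same_packing X Y : Prop :=
  forall k r, 0 < r -> packs X k r <-> packs Y k r.

Lemma same_packing_sym X Y : same_packing X Y -> same_packing Y X.
Proof. by move=> XY k r r0; split=> /(XY k r r0). Qed.

Lemma spaced_sub X r (A B : {set X}) :
  A \subset B -> spaced r B -> spaced r A.
Proof. by move=> /fintype.subsetP AB sB x y /AB xB /AB yB; apply: sB. Qed.

Lemma packs_leq X k k' r : (k' <= k)%N -> packs X k r -> packs X k' r.
Proof.
move=> k'k [A Ak As].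
exists [set x in take k' (enum A)]%SET.
  rewrite cardsE (card_uniqP _) ?take_uniq ?enum_uniq//.
  by rewrite size_takel// -cardE Ak.
apply: spaced_sub As; apply/fintype.subsetP => x.
by rewrite inE => /mem_take; rewrite mem_enum.
Qed.

Lemma strictly_spacedP X s (A : {set X}) :
  strictly_spaced s A -> exists2 r, s < r & spaced r A.
Proof.
move=> sA.
(* The default [s + 1] serves sets with at most one point. *)
exists (\big[Num.min/s + 1]_(p : X * X | [&& p.1 \in A, p.2 \in A & p.1 != p.2])
          mdist p.1 p.2).
  apply: lt_bigmin => [|[x y] /and3P[xA yA xy]]; first by rewrite ltrDl.
  exact: sA.
move=> x y xA yA xy.
by apply: (@bigmin_le_cond _ _ _ _ (x, y)); rewrite /= xA yA.
Qed.

Lemma packs_strict X k s :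
  (exists2 A : {set X}, #|A| = k & strictly_spaced s A) <->
  (exists2 r, s < r & packs X k r).
Proof.
split=> [[A Ak /strictly_spacedP[r sr rA]]|[r sr [A Ak rA]]].
  by exists r => //; exists A.
by exists A => // x y xA yA xy; apply: (lt_le_trans sr); apply: rA.
Qed.

Lemma packs_limit X k r : 0 < r ->
  (forall r', 0 < r' < r -> packs X k r') -> packs X k r.
Proof.
move=> r0 H.
(* No distance lies strictly between [m] and [r], so spacing [(m + r) / 2] is already spacing [r].
   The default [r / 2] keeps this threshold positive. *)
pose m := \big[Num.max/r / 2]_(p : X * X | mdist p.1 p.2 < r) mdist p.1 p.2.
have mr : m < r by apply: bigmax_lt => //; lra.
have rm : r / 2 <= m by exact: bigmax_ge_id.
have [|A Ak As] := H ((m + r) / 2); first by apply/andP; split; lra.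
exists A => // x y xA yA xy; rewrite leNgt; apply/negP => lt_xy.
have := @le_bigmax_cond _ _ _ (r / 2) (x, y)
  (fun p : X * X => mdist p.1 p.2 < r) (fun p => mdist p.1 p.2) lt_xy.
rewrite -/m /=; have := As x y xA yA xy; lra.
Qed.

Lemma eq_card_imset (S T : finType) (A : {set S}) (B : {set T}) (y0 : T) :
  #|A| = #|B| -> exists2 f : S -> T, {in A &, injective f} & f @: A = B.
Proof.
move=> AB; pose f x := nth y0 (enum B) (index x (enum A)).
have ltf x : x \in A -> (index x (enum A) < size (enum B))%N.
  by move=> xA; rewrite -cardE -AB cardE index_mem mem_enum.
have fI : {in A &, injective f}.
  move=> x x' xA x'A /eqP; rewrite nth_uniq ?ltf ?enum_uniq// => /eqP eqi.
  by apply: (index_inj x (s := enum A)); rewrite ?mem_enum.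
exists f => //; apply/eqP; rewrite eqEcard card_in_imset// AB leqnn andbT.
apply/fintype.subsetP => _ /imsetP[x xA ->].
by rewrite -mem_enum mem_nth// ltf.
Qed.

Lemma ultrametric_lt X r (x y z : X) : ultrametric X ->
  mdist x y < r -> mdist y z < r -> mdist x z < r.
Proof.
by move=> uX xy yz; apply: le_lt_trans (uX x y z) _; rewrite gt_max xy.
Qed.

Lemma ultrametric_le X r (x y z : X) : ultrametric X ->
  mdist x y <= r -> mdist y z <= r -> mdist x z <= r.
Proof. by move=> uX xy yz; apply: le_trans (uX x y z) _; rewrite ge_max xy. Qed.

Lemma ultrametric_isosceles X (x y z : X) : ultrametric X ->
  mdist x y < mdist x z -> mdist y z = mdist x z.
Proof.
move=> uX xyz; apply/eqP; rewrite eq_le; apply/andP; split.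
  by apply: (ultrametric_le (y := x)) => //; rewrite metric_sym ltW.
rewrite leNgt; apply/negP => yzx.
by have := ultrametric_lt uX xyz yzx; rewrite ltxx.
Qed.

(* Breaking ties by a rule that depends only on the distances to [C] makes the
   choice constant on balls of radius [r]: by the isosceles property, points of
   such a ball far from [C] have the same distances to [C]. *)
Lemma nearest_point Y r (C : {set Y}) (c0 : Y) :
  ultrametric Y -> c0 \in C -> spaced r C ->
  exists c : Y -> Y, [/\ forall y, c y \in C,
    forall y b, b \in C -> mdist y (c y) <= mdist y b &
    forall y y', mdist y y' < r -> c y = c y'].
Proof.
move=> uY c0C sC.
pose P y a := (a \in C) && [forall b in C, mdist y a <= mdist y b].
pose c y := odflt c0 [pick a | P y a].
have cP y : P y (c y).
  rewrite /c; case: pickP => //= noP.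
  case: (Order.TotalTheory.arg_minP (P := mem C) (mdist y) c0C) => a aC amin.
  have := noP a; rewrite /P (aC : a \in C) => /negbT/forall_inPn[b bC].
  by rewrite (amin b bC).
have cC y : c y \in C by have /andP[] := cP y.
have cmin y b : b \in C -> mdist y (c y) <= mdist y b.
  by move=> bC; have /andP[_ /forall_inP] := cP y; apply.
exists c; split=> // y y' yy'.
(* If [C] meets the open [r]-ball, both chosen points lie in that ball and coincide by the spacing
   of [C]. *)
have [[a /andP[aC ya]]|far] := pselect (exists a, (a \in C) && (mdist y a < r)).
  have y'a : mdist y' a < r by apply: ultrametric_lt ya => //; rewrite metric_sym.
  apply/eqP/negPn/negP => /sC; rewrite leNgt => /(_ (cC y) (cC y')) /negP; apply.
  apply: (ultrametric_lt (y := y)) => //.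
    by rewrite metric_sym; apply: le_lt_trans (cmin _ _ aC) ya.
  apply: (ultrametric_lt (y := y')) => //.
  exact: le_lt_trans (cmin _ _ aC) y'a.
have eqd a : a \in C -> mdist y' a = mdist y a.
  move=> aC; apply: ultrametric_isosceles => //; apply: lt_le_trans yy' _.
  by rewrite leNgt; apply/negP => ya; apply: far; exists a; rewrite aC.
rewrite /c; congr odflt; apply: eq_pick => a; rewrite /P /=.
case: (boolP (a \in C)) => //= aC; apply: eq_forallb_in => b bC.
by rewrite !eqd.
Qed.

(* A spaced set of [n] points whose [s]-neighbourhood is maximal must be an
   [s]-net: a point [y] outside the neighbourhood could replace one of two
   points of the set at distance at most [s], enlarging the neighbourhood. *)
Lemma spaced_net Y n r s : ultrametric Y -> 0 <= s -> packs Y n r ->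
  (forall A : {set Y}, strictly_spaced s A -> (#|A| <= n)%N) ->
  exists C : {set Y}, [/\ #|C| = n, spaced r C &
    forall y, exists2 c, c \in C & mdist y c <= s].
Proof.
move=> uY s0 [B Bn Bs] ub.
pose N (C : {set Y}) := [set y | [exists c in C, mdist y c <= s]]%SET.
pose P (C : {set Y}) := (#|C| == n) && `[< spaced r C >].
have PB : P B by rewrite /P Bn eqxx; apply/asboolP.
case: (arg_maxnP (fun C => #|N C|) PB) => C /andP[/eqP Cn /asboolP Cs] Cmax.
exists C; split=> // y; apply: contrapT => noc.
have yC c : c \in C -> s < mdist y c.
  by move=> cC; rewrite ltNge; apply/negP => yc; apply: noc; exists c.
have yNC : y \notin C by apply/negP => /yC; rewrite mdistxx ltNge s0.
have [a [b [aC bC ab abs]]] :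
    exists a b, [/\ a \in C, b \in C, a != b & mdist a b <= s].
  apply: contrapT => noab.
  suff /ub : strictly_spaced s (y |: C)%SET by rewrite cardsU1 yNC Cn ltnn.
  move=> x z.
  rewrite !inE => /orP[/eqP->|xC] /orP[/eqP->|zC] xz.
  - by rewrite eqxx in xz.
  - exact: yC.
  - by rewrite metric_sym; exact: yC.
  - by rewrite ltNge; apply/negP => xzs; apply: noab; exists x, z.
pose C' := (y |: C :\ a)%SET.
have yD : y \notin (C :\ a)%SET by rewrite !inE negb_and yNC orbT.
have C'n : #|C'| = n by rewrite cardsU1 yD -Cn (cardsD1 a C) aC.
have far c : c \in C -> r <= mdist y c.
  by move=> /yC/ltW; apply: le_trans; apply: le_trans abs; apply: Cs.
have C's : spaced r C'.
  move=> x z; rewrite !inE => /orP[/eqP->|/andP[_ xC]] /orP[/eqP->|/andP[_ zC]] xz.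
  - by rewrite eqxx in xz.
  - exact: far.
  - by rewrite metric_sym; exact: far.
  - exact: Cs.
have PC' : P C' by rewrite /P C'n eqxx; apply/asboolP.
have /= := Cmax C' PC'; rewrite leqNgt => /negP; apply; apply: proper_card.
apply/fintype.properP; split.
  (* Points covered by [a] are still covered by [b], since [a] and [b] are within [s] of each
     other. *)
  apply/fintype.subsetP => z; rewrite !inE => /exists_inP[c cC zc]; apply/exists_inP.
  have [ca|ca] := eqVneq c a; last by exists c => //; rewrite !inE ca cC orbT.
  exists b; first by rewrite !inE (eq_sym b a) ab bC orbT.
  by apply: (ultrametric_le (y := a)) => //; rewrite -ca.
exists y; first by rewrite inE; apply/exists_inP; exists y; rewrite ?finset.setU11 ?mdistxx.
by rewrite inE; apply/exists_inP => -[c /yC]; rewrite ltNge => /negP.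
Qed.

(** * Correspondences with equidistant spaces *)

Definition equidistant (S : metricType R) (mu : R) : Prop :=
  forall t t' : S, t != t' -> mdist t t' = mu.

(** Each index is related to the cell of points whose chosen nearest point of [C] is its own. A cell
    has diameter at most [s] by the ultrametric inequality, and distinct cells are at least [mu - s]
    apart because the choice is constant on open balls of that radius. *)
Lemma net_correspondence (S : metricType R) (mu s : R) Y (C : {set Y})
    (w : S -> Y) :
  inhabited S -> equidistant S mu -> ultrametric Y ->
  (forall y y' : Y, mdist y y' <= mu + s) -> spaced (mu - s) C ->
  (forall y, exists2 c, c \in C & mdist y c <= s) ->
  injective w -> (forall y, y \in C <-> exists t, w t = y) ->
  exists Q : S -> Y -> Prop, correspondence s Q.
Proof.
move=> [t0] eS uY diamY sC net wI wC.
have wtC t : w t \in C by apply/wC; exists t.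
have [c [cC cmin ceq]] := nearest_point uY (wtC t0) sC.
have cs y : mdist y (c y) <= s.
  by have [b bC yb] := net y; apply: le_trans (cmin _ _ bC) yb.
exists (fun t y => c y = w t); split.
- move=> t; exists (w t); apply/esym/mdist_positivity/le_anti.
  by rewrite mdist_ge0 andbT -(mdistxx (w t)) cmin.
- by move=> y; have /wC[t <-] := cC y; exists t.
- move=> t t' y y' cy cy'; have [tt'|tt'] := eqVneq t t'.
    rewrite tt' mdistxx sub0r normrN ger0_norm ?mdist_ge0//.
    apply: (ultrametric_le (y := c y)) => //.
    by rewrite cy tt' -cy' metric_sym.
  rewrite eS// ler_distlC; apply/andP; split; last exact: diamY.
  rewrite leNgt; apply/negP => /ceq; rewrite cy cy' => /wI tt.
  by rewrite tt eqxx in tt'.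
Qed.

Lemma correspondence_same_packing (S : metricType R) (mu s : R) X Y
    (Q : S -> X -> Prop) :
  inhabited S -> equidistant S mu -> 0 < mu -> ultrametric Y ->
  same_packing X Y -> correspondence s Q ->
  exists Q' : S -> Y -> Prop, correspondence s Q'.
Proof.
move=> [t0] eS mu0 uY XY [QS QX Qd].
have [w wQ] := choice QS; have [u uQ] := choice QX.
have s0 : 0 <= s by apply: le_trans (Qd _ _ _ _ (wQ t0) (wQ t0)).
have [y0 _] : exists y : Y, True.
  have : packs X 1 1.
    exists [set w t0]%SET; first by rewrite cards1.
    by move=> x y; rewrite !inE => /eqP -> /eqP ->; rewrite eqxx.
  by move=> /XY[]// A /eqP/cards1P[y _] _; exists y.
have leS (t t' : S) : mdist t t' <= mu.
  by have [->|tt'] := eqVneq t t'; [rewrite mdistxx ltW | rewrite eS].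
have diamY (y y' : Y) : mdist y y' <= mu + s.
  rewrite leNgt; apply/negP => lt_yy'.
  have yy'0 : 0 < mdist y y' by apply: le_lt_trans lt_yy'; lra.
  have : packs Y 2 (mdist y y').
    exists [set y; y']%SET; first by rewrite cards2 -mdist_gt0 yy'0.
    move=> a b; rewrite !inE => /orP[]/eqP-> /orP[]/eqP->; rewrite ?eqxx//.
    by rewrite metric_sym.
  move=> /XY[]// A /eqP/cards2P[x [x' [xx' ->]]].
  move=> /(_ x x'); rewrite !inE !eqxx orbT => /(_ isT isT xx').
  have := Qd _ _ _ _ (uQ x) (uQ x').
  have := leS (u x) (u x'); rewrite ler_norml => ? /andP[? _] ?.
  by lra.
have uI (A : {set X}) : strictly_spaced s A -> {in A &, injective u}.
  move=> sA x x' xA x'A uxx'; apply/eqP/negPn/negP => /(sA _ _ xA x'A).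
  have := Qd _ _ _ _ (uQ x) (uQ x').
  by rewrite uxx' mdistxx sub0r normrN ger0_norm ?mdist_ge0// leNgt => /negP.
(* Finiteness turns strict spacing above [s] into spacing at some larger, hence positive, threshold,
   to which [same_packing] applies. *)
have toX (A : {set Y}) : strictly_spaced s A ->
    exists2 A' : {set X}, #|A'| = #|A| & strictly_spaced s A'.
  move=> sA; apply/packs_strict.
  have [r sr rA] := strictly_spacedP sA; exists r => //.
  by apply/XY; [exact: le_lt_trans sr | exists A].
have [smu|mus] := ltP s mu; last first.
  (* Here [mu - s <= 0], so distinct indices impose only the diameter bound. A maximal strictly
     spaced set is an [s]-net, and it remains to map [S] onto it. *)
  pose P (A : {set Y}) := `[< strictly_spaced s A >].
  have P0 : P finset.set0 by apply/asboolP => x y; rewrite inE.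
  case: (arg_maxnP (fun A : {set Y} => #|A|) P0) => A /asboolP sA Amax.
  have net y : exists2 a, a \in A & mdist a y <= s.
    apply: contrapT => noa.
    have ya a : a \in A -> s < mdist a y.
      by move=> aA; rewrite ltNge; apply/negP => ?; apply: noa; exists a.
    have yA : y \notin A by apply/negP => /ya; rewrite mdistxx ltNge s0.
    have : P (y |: A)%SET.
      apply/asboolP => x z; rewrite !inE.
      move=> /orP[/eqP->|xA] /orP[/eqP->|zA] xz; [|rewrite metric_sym| |].
      - by rewrite eqxx in xz.
      - exact: ya.
      - exact: ya.
      - exact: sA.
    by move=> /Amax /=; rewrite cardsU1 yA ltnn.
  have [a0 a0A _] := net y0.
  have [A' A'A sA'] := toX _ sA.
  have [f fI fA] := eq_card_imset (w t0) (esym A'A).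
  have vI : {in A &, injective (u \o f)}.
    move=> a b aA bA /= /(uI _ sA') fab; apply: fI => //.
    by apply: fab; rewrite -fA imset_f.
  (* The map [c] inverts the injection [u \o f] on its image and sends all other indices to [a0], so
     it reaches every point of [A]. *)
  have /choice[c cP] t : exists a, (a \in A) /\
      (forall b, b \in A -> u (f b) = t -> a = b).
    have [[a [aA at']]|no] := pselect (exists a, (a \in A) /\ u (f a) = t).
      by exists a; split=> // b bA bt; apply: vI => //=; rewrite bt.
    by exists a0; split=> // b bA bt; case: no; exists b.
  exists (fun t y => mdist (c t) y <= s); split=> [t|y|t t' y y' ty t'y'].
  - by exists (c t); rewrite mdistxx.
  - have [a aA ay] := net y; exists (u (f a)).
    by have [_ caE] := cP (u (f a)); rewrite (caE a).
  - have [tt'|tt'] := eqVneq t t'.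
      rewrite tt' mdistxx sub0r normrN ger0_norm ?mdist_ge0//.
      by apply: (ultrametric_le (y := c t)) => //; rewrite ?tt' // metric_sym -tt'.
    rewrite eS// ler_distlC diamY andbT.
    by apply: le_trans (mdist_ge0 y y'); rewrite subr_le0.
pose A := [set x | `[< exists t, w t = x >]]%SET.
have wsep t t' : t != t' -> mu - s <= mdist (w t) (w t').
  move=> tt'; have := Qd _ _ _ _ (wQ t) (wQ t').
  by rewrite eS// ler_norml => /andP[_]; lra.
have wI : injective w.
  move=> t t' wtt'; apply/eqP/negPn/negP => /wsep.
  by rewrite wtt' mdistxx; lra.
have wA t : w t \in A by rewrite inE; apply/asboolP; exists t.
have Aw x : x \in A -> exists t, w t = x by rewrite inE => /asboolP.
have packsX : packs X #|A| (mu - s).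
  exists A => // x y /Aw[t <-] /Aw[t' <-] tt'.
  by apply: wsep; apply: contraNneq tt' => ->.
have [C [CA sC net]] : exists C : {set Y}, [/\ #|C| = #|A|, spaced (mu - s) C &
    forall y, exists2 c, c \in C & mdist y c <= s].
  apply: spaced_net => //; first by apply/XY => //; rewrite subr_gt0.
  (* A strictly spaced set of [X] injects into [S] by [u], then into [A] by [w]; this bounds its
     size although [S] is not a finite type. *)
  move=> B /toX[B' <- /uI B'I].
  rewrite -(card_in_imset (f := w \o u) (D := mem B')); last first.
    by move=> x x' xB x'B /= /wI; apply: B'I.
  apply: subset_leq_card; apply/fintype.subsetP => _ /imsetP[x _ ->].
  exact: wA.
have [f fI fA] := eq_card_imset y0 (esym CA).
apply: (net_correspondence (C := C) (w := f \o w)) (eS) uY diamY sC net _ _ => //.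
  by move=> t t' /= /fI => /(_ (wA t) (wA t')) /wI.
move=> y; rewrite -fA; split=> [/imsetP[_ /Aw[t <-] ->]|[t <-]]; first by exists t.
exact: imset_f.
Qed.

End Packing.

(** * Distances to simplexes *)

Lemma gh_dist_ge0 (R : realType) (X Y : metricType R) :
  inhabited X -> (0 <= gh_dist X Y)%E.
Proof.
move=> [x0]; apply: le_ereal_inf_tmp => _ [r [Z [f [g [_ _ fg]]]] <-].
apply: le_trans fg; rewrite le_max; apply/orP; left.
apply: (@le_trans _ _ (dist_to_set (f x0) (range g))).
  by apply: le_ereal_inf_tmp => _ [z _ <-]; rewrite lee_fin mdist_ge0.
by apply: ereal_sup_ubound; exists (f x0) => //; exists x0.
Qed.

Lemma simplex_equidistant (R : realType) (lam : R) (T : Type) : 0 < lam ->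
  equidistant (simplex lam T) lam /\
  exists2 e : T -> simplex lam T, injective e & forall t, exists i, e i = t.
Proof.
move=> lam0; rewrite /simplex; case: pselect => // lam_gt0; split.
  move=> t t' tt'; rewrite -[LHS]/(lam * (t != t')%:R).
  by rewrite tt' mulr1.
by exists id => // t; exists t.
Qed.

(** A one-point space is equidistant for any [mu], so the degenerate simplex can be treated with a
    positive [mu]. *)
Lemma simplex0_equidistant (R : realType) (lam mu : R) (T : Type) : lam <= 0 ->
  equidistant (simplex lam T) mu /\ inhabited (simplex lam T).
Proof.
move=> lam0; rewrite /simplex; case: pselect => [lam_gt0|_].
  by have := lam_gt0; rewrite ltNge lam0.
by split; [move=> [] []; rewrite eqxx | exists; exact: tt].
Qed.

Lemma gh_dist_same_packing (R : realType) (S : metricType R) (mu : R)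
    (X Y : finMetricType R) :
  inhabited S -> equidistant S mu -> 0 < mu -> ultrametric Y ->
  same_packing X Y -> (gh_dist S Y <= gh_dist S X)%E.
Proof.
move=> S0 eS mu0 uY XY; rewrite leNgt; apply/negP => /ereal_inf_lt[].
move=> _ [r [Z [f [g [fi gi fg]]]] <-] rY.
have : (gh_dist S X <= r%:E)%E.
  by apply: ereal_inf_lbound; exists r => //; exists Z, f, g.
(* The slack [e] provides the strict inequality needed to extract a correspondence, and a positive
   radius to glue with. *)
move: rY; rewrite ltNge => /negP rY rX; apply: rY; apply/lee_addgt0Pr => e e0.
have rXe : (gh_dist S X < (r + e)%:E)%E.
  by apply: le_lt_trans rX _; rewrite lte_fin ltrDl.
have re0 : 0 < r + e.
  by rewrite -lte_fin; apply: le_lt_trans rXe; exact: gh_dist_ge0.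
have [Q QP] := correspondence_gh_dist rXe.
have [Q' Q'P] := correspondence_same_packing S0 eS mu0 uY XY QP.
exact: gh_dist_correspondence re0 Q'P.
Qed.

Lemma same_packing_indistinguishable (R : realType) (X Y : finMetricType R) :
  ultrametric X -> ultrametric Y -> same_packing X Y -> indistinguishable X Y.
Proof.
move=> uX uY XY T lam [t] lam0; apply/le_anti.
have [mu [eS S0 mu0]] : exists mu : R,
    [/\ equidistant (simplex lam T) mu, inhabited (simplex lam T) & 0 < mu].
  have [lam1|lam1] := ltP 0 lam.
    have [eS [e _ _]] := simplex_equidistant T lam1; exists lam; split=> //.
    exact: inhabits (e t).
  by have [eS S0] := simplex0_equidistant 1 T lam1; exists 1.
by rewrite !(@gh_dist_same_packing _ _ mu) //; exact: same_packing_sym.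
Qed.

(* For [lam] larger than [r] plus the diameter of [X], the distortion
   [lam - r] is attained exactly when [X] contains [k] points at mutual
   distances at least [r]. *)
Lemma indistinguishable_packs (R : realType) (X Y : finMetricType R) k (r : R) :
  ultrametric X -> indistinguishable X Y -> 0 < r -> packs X k r -> packs Y k r.
Proof.
move=> uX XY r0 [A Ak As]; have [k0|k0] := posnP k.
  by exists finset.set0; rewrite ?cards0 ?k0// => x y; rewrite inE.
pose D := \big[Num.max/0]_(p : X * X) mdist p.1 p.2.
have leD (x x' : X) : mdist x x' <= D by exact: (le_bigmax _ _ (x, x')).
have D0 : 0 <= D by exact: bigmax_ge_id.
(* The distortion will be [D + 1], so that [lam - (D + 1) = r]; the summand [1] keeps it positive
   even when [D = 0]. *)
pose lam := r + D + 1; have lam0 : 0 < lam by rewrite /lam; lra.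
have [eS [e eI eS']] := simplex_equidistant 'I_k lam0.
have T0 : inhabited 'I_k by exists; exact: Ordinal k0.
have S0 : inhabited (simplex lam 'I_k) by case: T0 => i; exists; exact: (e i).
have [e' e'K] := choice eS'.
have e'I : injective e' by move=> t t' tt'; rewrite -(e'K t) tt' e'K.
have eK : cancel e e' by move=> i; apply: eI; rewrite e'K.
have [Q QP] : exists Q : simplex lam 'I_k -> X -> Prop, correspondence (D + 1) Q.
  pose w t : X := enum_val (cast_ord (esym Ak) (e' t)).
  apply: (net_correspondence (mu := lam) (C := A) (w := w)) => //.
  - by move=> y y'; apply: le_trans (leD y y') _; rewrite /lam; lra.
  - by have -> : lam - (D + 1) = r by rewrite /lam; lra.
  - have [x xA] : exists x, x \in A by apply/card_gt0P; rewrite Ak.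
    by move=> y; exists x => //; apply: le_trans (leD y x) _; lra.
  - by move=> t t' /enum_val_inj/cast_ord_inj/e'I.
  - move=> y; split=> [yA|[t <-]]; last exact: enum_valP.
    exists (e (cast_ord Ak (enum_rank_in yA y))).
    by rewrite /w eK cast_ordK enum_rankK_in.
have ghX : (gh_dist (simplex lam 'I_k) X <= ((D + 1) / 2)%:E)%E.
  apply: (@gh_dist_correspondence _ _ _ _ Q); first by lra.
  by have -> : 2 * ((D + 1) / 2) = D + 1 by lra.
(* Extracting a correspondence needs a strict bound on the distance, hence the passage to all [r']
   below [r]. *)
apply: packs_limit => // r' /andP[r'0 r'r].
have ghY : (gh_dist (simplex lam 'I_k) Y < ((lam - r') / 2)%:E)%E.
  rewrite -XY ?(ltW lam0)//; apply: le_lt_trans ghX _.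
  by rewrite lte_fin /lam; lra.
have [Q' [/choice[w wQ] _ Q'd]] := correspondence_gh_dist ghY.
have wd i j : i != j -> r' <= mdist (w (e i)) (w (e j)).
  move=> ij; have := Q'd _ _ _ _ (wQ (e i)) (wQ (e j)).
  rewrite eS ?(inj_eq eI)// ler_norml => /andP[_]; lra.
exists [set w (e i) | i in 'I_k]%SET.
  rewrite card_imset ?card_ord// => i j wij; apply/eqP/negPn/negP => /wd.
  by rewrite wij mdistxx leNgt r'0.
move=> _ _ /imsetP[i _ ->] /imsetP[j _ ->] ij; apply: wd.
by apply: contraNneq ij => ->.
Qed.

(** * Minimal spanning trees *)

(** Take for [h] the length of a shortest path to [x0]. *)
Lemma connect_descent (T : finType) (e : rel T) (x0 : T) :
  (forall x, connect e x x0) ->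
  exists h : T -> nat, forall x, x != x0 -> exists2 y, e x y & (h y < h x)%N.
Proof.
move=> ex0.
pose P x n := `[< exists p, [/\ path e x p, last x p = x0 & size p = n] >].
have /choice[h hP] x : exists n, P x n /\ forall m, P x m -> (n <= m)%N.
  have /connectP[p ep px] := ex0 x.
  have exP : exists n, P x n by exists (size p); apply/asboolP; exists p.
  by exists (ex_minn exP); case: ex_minnP.
exists h => x xx0; have [/asboolP[p [+ + <-]] _] := hP x.
case: p => [_ xE|y p /= /andP[xy yp] px]; first by rewrite -xE eqxx in xx0.
exists y => //; rewrite ltnS; have [_] := hP y; apply.
by apply/asboolP; exists p.
Qed.

Lemma set2_cross (T : finType) (x y x' y' : T) :
  [set x; y]%SET = [set x'; y']%SET -> x = x' \/ x = y' /\ y = x'.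
Proof.
move=> E.
have := set21 x y; rewrite E => /set2P[->|xy']; first by left.
by have := set21 x' y'; rewrite -E => /set2P[->|->]; [left | right].
Qed.

(** Following parents leads to [x0], whence connectedness. In a cycle, both neighbours of a vertex
    of largest rank would be its parent, but a cycle of length at least three has them distinct. *)
Lemma parent_tree (T : finType) (rank : T -> nat) (p : T -> T) (x0 : T) :
  (forall x, x != x0 -> (rank (p x) < rank x)%N) ->
  is_tree [set [set x; p x]%SET | x in [set~ x0]]%SET.
Proof.
move=> rp; set E := (E in is_tree E).
have adjP x y : Defs.adjacent E x y -> (x != x0 /\ y = p x) \/ (y != x0 /\ x = p y).
  move=> /imsetP[z]; rewrite !inE => zx0 E1.
  have [xz|[xp yz]] := set2_cross E1; last by right; rewrite yz.
  left; rewrite xz; split=> //; move: E1; rewrite xz.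
  rewrite finset.setUC [RHS]finset.setUC => /set2_cross[//|[yz zp]].
  by have := rp z zx0; rewrite -zp ltnn.
have adjC x y : Defs.adjacent E x y = Defs.adjacent E y x.
  by rewrite /Defs.adjacent finset.setUC.
split.
- move=> e /imsetP[x]; rewrite !inE => /rp rx ->; rewrite cards2.
  by have [xp|//] := eqVneq x (p x); rewrite -xp ltnn in rx.
- have to0 n x : (rank x < n)%N -> connect (Defs.adjacent E) x x0.
    elim: n x => // n IH x; rewrite ltnS => xn.
    have [->|xx0] := eqVneq x x0; first exact: connect0.
    apply: (@connect_trans _ _ (p x)); last exact/IH/(leq_trans (rp x xx0)).
    by apply: connect1; apply/imsetP; exists x; rewrite ?inE.
  move=> x y; apply: (connect_trans (to0 _ x (leqnn _))).
  by rewrite (sym_connect_sym adjC); apply: to0 (leqnn _).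
- move=> c c2 cE.
  have [c0 c0c] : exists c0, c0 \in c.
    by case: c c2 {cE} => // c0 c _; exists c0; rewrite mem_head.
  case: (arg_maxnP (P := fun x => x \in c) rank c0c) => x xc xmax.
  have px y : y \in c -> Defs.adjacent E x y -> y = p x.
    move=> yc /adjP[[] //|[/rp yx0 xpy]].
    by have /= := xmax y yc; rewrite leqNgt xpy yx0.
  have [i c' cx] := rot_to xc.
  have memc y : (y \in c) = (y \in x :: c') by rewrite -cx mem_rot.
  move: cE c2; rewrite -(rot_ucycle i) -(size_rot i) cx /ucycle.
  case: c' {cx} memc => [|y [|z c']] // memc.
  rewrite /= rcons_path => /andP[/and3P[xy _ /andP[_ zx]] /and3P[_ yN _]] _.
  rewrite adjC in zx.
  have lc : last z c' \in z :: c' by exact: mem_last.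
  have yE : y = p x by apply: px; rewrite // memc !inE eqxx orbT.
  have lE : last z c' = p x by apply: px; rewrite // memc 2!inE lc !orbT.
  by move: yN; rewrite yE -lE lc.
Qed.

Section Spectrum.
Variable R : realType.
Implicit Types (X Y : finMetricType R) (r : R) (k : nat).

Definition long_edges X r (E : {set {set X}}) : {set {set X}} :=
  [set e in E | r <= edge_length X e]%SET.

(* Contracting the edges shorter than [r] identifies no two points of [A]; a
   path towards a fixed point of [A] leaves the open [r]-ball of every other
   point of [A] through a long edge, and these edges are distinct. *)
Lemma spaced_long_edges X r (E : {set {set X}}) (A : {set X}) :
  ultrametric X -> 0 < r -> (forall x y, connect (Defs.adjacent E) x y) ->
  spaced r A -> (#|A| <= #|long_edges r E|.+1)%N.
Proof.
move=> uX r0 cE As; have [->|[a0 a0A]] := set_0Vmem A; first by rewrite cards0.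
have [h hP] := connect_descent (fun x => cE x a0).
have /choice[F FP] a : exists xy : X * X, a \in (A :\ a0)%SET ->
    [/\ mdist a xy.1 < r, r <= mdist a xy.2, Defs.adjacent E xy.1 xy.2 &
        (h xy.2 < h xy.1)%N].
  have [|_] := boolP (a \in (A :\ a0)%SET); last by exists (a, a).
  rewrite !inE => /andP[aa0 aA].
  have aar : mdist a a < r by rewrite mdistxx.
  case: (arg_minnP (P := fun x => mdist a x < r) h aar) => x ax xmin.
  have [|y xy yx] := hP x.
    by apply: contraTneq ax => ->; rewrite -leNgt; exact: As.
  exists (x, y); split=> //=; rewrite leNgt; apply/negP => /xmin.
  by rewrite leqNgt yx.
have FI : {in (A :\ a0)%SET &, injective (fun a => [set (F a).1; (F a).2]%SET)}.
  move=> a b aA bA /set2_cross ab.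
  have [ax _ _ ha] := FP a aA; have [bx _ _ hb] := FP b bA.
  (* With equal orientations the two [r]-balls share a point, so [a = b]; with opposite ones [h]
     would decrease in both directions. *)
  case: ab => [ab|[ab ba]].
    apply/eqP/negPn/negP; move: aA bA; rewrite !inE => /andP[_ aA] /andP[_ bA].
    move=> /(As _ _ aA bA); rewrite leNgt => /negP; apply.
    by apply: ultrametric_lt uX ax _; rewrite ab metric_sym.
  by move: ha; rewrite ab ba ltnNge (ltnW hb).
rewrite (cardsD1 a0 A) a0A ltnS -(card_in_imset FI); apply: subset_leq_card.
apply/fintype.subsetP => _ /imsetP[a /FP[ax ay xy _] ->].
rewrite inE; apply/andP; split=> //; rewrite edge_length_set2 leNgt; apply/negP => xyr.
by have := ultrametric_lt uX ax xyr; rewrite ltNge ay.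
Qed.

(* The tree joins every point to a nearest one among its predecessors in an
   arbitrary enumeration of [X]. *)
Lemma long_edges_tree X : (0 < #|X|)%N ->
  exists2 E : {set {set X}}, is_tree E &
    forall r, packs X #|long_edges r E|.+1 r.
Proof.
move=> X0; pose rank (x : X) : nat := enum_rank x.
have rankI : injective rank by move=> x y /val_inj/enum_rank_inj.
pose x0 : X := enum_val (Ordinal X0).
have rank0 : rank x0 = 0%N by rewrite /rank enum_valK.
have rank_gt0 x : x != x0 -> (rank x0 < rank x)%N.
  by rewrite rank0 lt0n; apply: contraNneq; rewrite -rank0 => /rankI ->.
have /choice[p pP] x : exists y, x != x0 -> (rank y < rank x)%N /\
    forall z, (rank z < rank x)%N -> mdist x y <= mdist x z.
  have [_|/rank_gt0 xx0] := eqVneq x x0; first by exists x.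
  case: (Order.TotalTheory.arg_minP
    (P := fun y => (rank y < rank x)%N) (mdist x) xx0) => y yx ymin.
  by exists y.
have prank x : x != x0 -> (rank (p x) < rank x)%N by move=> /pP[].
exists [set [set x; p x]%SET | x in [set~ x0]]%SET; first exact: parent_tree prank.
move=> r; set E := (E in long_edges r E).
pose B := [set x | (x != x0) && (r <= mdist x (p x))]%SET.
exists (x0 |: B)%SET; last first.
  (* Of two points of the set, the later one in the enumeration is at distance at least [r] from all
     its predecessors. *)
  have H x y : x \in (x0 |: B)%SET -> (rank y < rank x)%N -> r <= mdist x y.
    rewrite !inE => /orP[/eqP->|/andP[/pP[_ xmin] rx] yx]; first by rewrite rank0.
    by apply: le_trans rx _; exact: xmin.
  move=> x y xA yA xy; case: (ltngtP (rank x) (rank y)) => [||/rankI xyE].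
  - by rewrite metric_sym; exact: H.
  - exact: H.
  - by rewrite xyE eqxx in xy.
have -> : long_edges r E = [set [set x; p x]%SET | x in B]%SET.
  apply/setP => e; rewrite inE; apply/andP/imsetP => [[/imsetP[x]]|[x]].
    rewrite !inE => xx0 ->; rewrite edge_length_set2 => rx.
    by exists x => //; rewrite inE xx0.
  rewrite inE => /andP[xx0 rx] ->; rewrite edge_length_set2; split=> //.
  by apply/imsetP; exists x; rewrite ?inE.
rewrite cardsU1 !inE eqxx /= add1n card_in_imset// => x y.
rewrite !inE => /andP[/prank rx _] /andP[/prank ry _] /set2_cross[//|[xy yx]].
by move: rx; rewrite yx xy ltnNge (ltnW ry).
Qed.

(** * Descending sequences and threshold counts *)

Lemma count_ge_eq0 (s : seq R) r :
  (forall x, x \in s -> x < r) -> count (>= r) s = 0%N.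
Proof.
move=> sr; apply/eqP; rewrite eqn0Ngt -has_count.
by apply/hasPn => x /sr; rewrite -ltNge.
Qed.

(** Domination of the counts means that [t] is no longer than [s] and lies below it entrywise. Equal
    sums then leave no room for a smaller entry or, by positivity, for extra entries of [s]. *)
Lemma sorted_dominated (s t : seq R) :
  sorted >=%R s -> sorted >=%R t ->
  (forall x, x \in s -> 0 < x) -> (forall x, x \in t -> 0 < x) ->
  (forall r, 0 < r -> (count (>= r) t <= count (>= r) s)%N) ->
  \sum_(x <- t) x <= \sum_(x <- s) x /\
  (\sum_(x <- s) x <= \sum_(x <- t) x -> s = t).
Proof.
elim: t s => [|b t IH] s.
  move=> _ _ s0 _ _; rewrite big_nil; split.
    by rewrite big_seq sumr_ge0// => x /s0/ltW.
  case: s s0 => // a s s0; rewrite big_cons leNgt => /negP[].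
  rewrite ltr_wpDr ?s0 ?mem_head// big_seq sumr_ge0// => x xs.
  by rewrite ltW// s0// inE xs orbT.
have ge_trans : transitive (>=%R : rel R) by move=> x y z xy /le_trans; exact.
case: s => [|a s] ss st s0 t0 cst.
  by have := cst b (t0 b (mem_head _ _)); rewrite /= lexx.
have b0 : 0 < b by rewrite t0 ?mem_head.
have sa x : x \in s -> x <= a.
  by move=> xs; have /allP/(_ x xs) := order_path_min ge_trans ss.
have tb x : x \in t -> x <= b.
  by move=> xt; have /allP/(_ x xt) := order_path_min ge_trans st.
have ab : b <= a.
  rewrite leNgt; apply/negP => ab; have := cst b b0.
  rewrite /= lexx leNgt ab (@count_ge_eq0 s)// => x /sa xa.
  exact: le_lt_trans ab.
have [||x xs|x xt|r r0|le_ts eq_st] := IH s; rewrite ?(path_sorted ss) ?(path_sorted st)//.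
- by rewrite s0// inE xs orbT.
- by rewrite t0// inE xt orbT.
(* For [r <= b] both heads are counted and cancel; for [r > b] nothing in [t] is counted. *)
- have [rb|br] := leP r b.
    by have := cst r r0; rewrite /= rb (le_trans rb ab).
  by rewrite (@count_ge_eq0 t)// => x /tb xb; apply: le_lt_trans br.
rewrite !big_cons; split; first exact: lerD.
move=> le_st; have ba : a <= b by lra.
have -> : a = b by apply/le_anti; rewrite ba.
by rewrite eq_st//; lra.
Qed.

Lemma sorted_count_eq (s t : seq R) :
  sorted >=%R s -> sorted >=%R t ->
  (forall x, x \in s -> 0 < x) -> (forall x, x \in t -> 0 < x) ->
  (forall r, 0 < r -> count (>= r) s = count (>= r) t) -> s = t.
Proof.
move=> ss st s0 t0 cst.
have [|_] := sorted_dominated ss st s0 t0; first by move=> r /cst ->.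
by apply; have [|] := sorted_dominated st ss t0 s0; first by move=> r /cst ->.
Qed.

Lemma edge_lengths_perm X (E : {set {set X}}) :
  perm_eq (edge_lengths X E) [seq edge_length X e | e <- enum E].
Proof. by rewrite perm_sort. Qed.

Lemma edge_lengths_sorted X (E : {set {set X}}) : sorted >=%R (edge_lengths X E).
Proof. by apply: sort_sorted => x y; exact: le_total. Qed.

Lemma edge_lengths_gt0 X (E : {set {set X}}) x :
  is_tree E -> x \in edge_lengths X E -> 0 < x.
Proof.
move=> [E2 _ _]; rewrite (perm_mem (edge_lengths_perm E)) => /mapP[e].
rewrite mem_enum => /E2/eqP/cards2P[y [z [yz ->]]] ->.
by rewrite edge_length_set2 mdist_gt0.
Qed.

Lemma count_edge_lengths X (E : {set {set X}}) r :
  count (>= r) (edge_lengths X E) = #|long_edges r E|.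
Proof.
rewrite (permP (edge_lengths_perm E)) count_map cardE -size_filter.
apply/perm_size/uniq_perm => [||e]; first by rewrite filter_uniq// enum_uniq.
  exact: enum_uniq.
by rewrite mem_filter !mem_enum andbC [RHS]inE.
Qed.

Lemma sum_edge_lengths X (E : {set {set X}}) :
  \sum_(x <- edge_lengths X E) x = total_length X E.
Proof. by rewrite (perm_big _ (edge_lengths_perm E)) big_map big_enum. Qed.

Lemma mst_spectrumP X : (0 < #|X|)%N ->
  exists2 E : {set {set X}}, is_mst X E & mst_spectrum X = edge_lengths X E.
Proof.
by move=> /mst_exists exE; eexists; last reflexivity; exact: (xgetPex _ exE).
Qed.

(** The nearest-predecessor tree [E'] has threshold counts dominated by those of the minimal tree
    [E]. As [E] is not longer in total, the two sorted length sequences coincide. *)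
Lemma packs_mst_spectrum X k r : ultrametric X -> (0 < #|X|)%N -> 0 < r ->
  packs X k r <-> (k <= (count (>= r) (mst_spectrum X)).+1)%N.
Proof.
move=> uX X0 r0; have [E [Et Emin] ->] := mst_spectrumP X0.
have [E' E't E'P] := long_edges_tree X0.
have dom r' (A : {set X}) : 0 < r' -> spaced r' A ->
    (#|A| <= (count (>= r') (edge_lengths X E)).+1)%N.
  move=> r'0; rewrite count_edge_lengths; apply: spaced_long_edges => //.
  by case: Et.
have [||||r' r'0|_ eqE] := @sorted_dominated (edge_lengths X E) (edge_lengths X E').
- exact: edge_lengths_sorted.
- exact: edge_lengths_sorted.
- by move=> x; apply: edge_lengths_gt0.
- by move=> x; apply: edge_lengths_gt0.
- have [A AE As] := E'P r'.
  by rewrite count_edge_lengths -ltnS -AE; apply: dom.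
split=> [[A <-]|]; first exact: dom.
rewrite eqE ?sum_edge_lengths; last exact: Emin.
by rewrite count_edge_lengths => kE; apply: packs_leq kE (E'P r).
Qed.

Lemma mst_spectrum_sorted X : (0 < #|X|)%N -> sorted >=%R (mst_spectrum X).
Proof. by move=> /mst_spectrumP[E _ ->]; exact: edge_lengths_sorted. Qed.

Lemma mst_spectrum_gt0 X x : (0 < #|X|)%N -> x \in mst_spectrum X -> 0 < x.
Proof. by move=> /mst_spectrumP[E [Et _] ->]; exact: edge_lengths_gt0. Qed.

Lemma same_packing_mst_spectrum X Y :
  ultrametric X -> ultrametric Y -> (0 < #|X|)%N -> (0 < #|Y|)%N ->
  same_packing X Y <-> mst_spectrum X = mst_spectrum Y.
Proof.
move=> uX uY X0 Y0; split=> [XY|XY k r r0]; last first.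
  by rewrite !packs_mst_spectrum// XY.
have cXY r : 0 < r ->
    count (>= r) (mst_spectrum X) = count (>= r) (mst_spectrum Y).
  move=> r0; apply/eqP; rewrite eqn_leq -!(ltnS (count _ _)).
  apply/andP; split.
    by apply/(packs_mst_spectrum _ uY Y0 r0)/XY/packs_mst_spectrum.
  by apply/(packs_mst_spectrum _ uX X0 r0)/XY/packs_mst_spectrum.
by apply: sorted_count_eq => // [||x|x]; try exact: mst_spectrum_sorted;
  exact: mst_spectrum_gt0.
Qed.

(** Below the smallest non-zero distance, the whole of [X] is a spaced set. *)
Lemma same_packing_leq_card X Y : same_packing X Y -> (#|X| <= #|Y|)%N.
Proof.
move=> XY; have [r r0 Xr] : exists2 r, 0 < r & spaced r [set: X]%SET.
  by apply: strictly_spacedP => x y _ _; rewrite mdist_gt0.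
have [|A <- _] := (XY #|X| r r0).1; last exact: max_card.
by exists [set: X]%SET; rewrite ?cardsT.
Qed.

End Spectrum.

Theorem corollary6p2 (R : realType) (X Y : finMetricType R)
    (X_nonempty : (0 < #|X|)%N) (Y_nonempty : (0 < #|Y|)%N)
    (X_ultrametric : ultrametric X) (Y_ultrametric : ultrametric Y) :
  indistinguishable X Y <->
  (#|X| = #|Y| /\ mst_spectrum X = mst_spectrum Y).
Proof.
split=> [XY|[_ XY]]; last first.
  by apply: same_packing_indistinguishable => //; apply/same_packing_mst_spectrum.
have YX : indistinguishable Y X by move=> T lam T0 lam0; rewrite XY.
have pXY : same_packing X Y.
  by move=> k r r0; split; exact: indistinguishable_packs.
split; last exact/same_packing_mst_spectrum.
by apply/eqP; rewrite eqn_leq !same_packing_leq_card//; exact: same_packing_sym.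
Qed.
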